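(* Let $P_1,\dots,P_7$ be the seven eigenpoints of a regular ternary cubic form over $\mathbb{C}$, and suppose they are in a strict $(C_5)$ configuration. Then \[ P_1=P_2\times P_4 \] and the points $P_1,\dots,P_6$ satisfy \[ s_{26}(s_{45}s_{13}-s_{34}s_{15})+s_{46}(s_{25}s_{13}-s_{23}s_{15})=0 . \] Moreover, the points $P_6$ and $P_7$ can be determined as follows: \[ P_6=(s_{15}s_{24}s_{34}+s_{15}s_{23}s_{44}-s_{13}s_{25}s_{44}-s_{13}s_{24}s_{45})\,P_2+(s_{13}s_{24}s_{25}-2s_{15}s_{22}s_{34}+s_{13}s_{22}s_{45})\,P_4, \] \[ P_7=(s_{26}s_{15}s_{46}+s_{24}s_{15}s_{66})\,P_1+s_{11}(s_{26}s_{45}+s_{24}s_{56})\,P_6 . \]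
   Context: Work in $\mathbb{P}^2_{\mathbb{C}}$. For a nonzero ternary cubic form $f$, the eigenscheme $E(f)\subset\mathbb{P}^2$ is defined by the $2\times2$ minors of $\begin{pmatrix}x&y&z\\ \partial_xf&\partial_yf&\partial_zf\end{pmatrix}$; its points are the eigenpoints of $f$. $f$ is regular if $E(f)$ is reduced of dimension $0$ (it then has $7$ points). Put $s_{ij}=\langle P_i,P_j\rangle$ with $\langle (A,B,C),(A',B',C')\rangle=AA'+BB'+CC'$ (for chosen representing vectors), and let $\times$ be the cross product of representing vectors in $\mathbb{C}^3$. Equalities of points are equalities in $\mathbb{P}^2$; the right-hand sides are multihomogeneous expressions in the coordinates of the points involved. Seven distinct points $P_1,\dots,P_7$ are in a $(C_5)$ configuration if the triples $(P_1,P_2,P_3)$, $(P_1,P_4,P_5)$, $(P_1,P_6,P_7)$, $(P_2,P_4,P_6)$ are aligned; the configuration is strict if there are no other aligned triples among them. *)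

(* Defs.v *)
From HB Require Import structures.
From mathcomp Require Import all_boot all_order all_algebra.
From mathcomp Require Import reals complex.
From mathcomp Require Import mpoly.

Set Implicit Arguments.
Unset Strict Implicit.
Unset Printing Implicit Defensive.

Import Order.TTheory GRing.Theory Num.Theory.
Local Open Scope ring_scope.

Section Ideals.
Variable A : comNzRingType.
Implicit Types I p q : A -> Prop.

Definition radical_ideal I : Prop := forall (n : nat) (a : A), I (a ^+ n) -> I a.

Record prime_ideal p : Prop := PrimeIdeal {
  prime_ideal0 : p 0;
  prime_idealD : forall a b, p a -> p b -> p (a + b);
  prime_idealM : forall a b, p b -> p (a * b);
  prime_ideal1 : ~ p 1;
  prime_idealP : forall a b, p (a * b) -> p a \/ p b }.

(* Primes of A containing I correspond to the points of Spec (A / I). *)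
Definition prime_over I p : Prop := prime_ideal p /\ forall a, I a -> p a.

End Ideals.

Section ProjectivePlane.
Variable K : fieldType.
Implicit Types (f : {mpoly K[3]}) (u v w : 'rV[K]_3) (P : 7.-tuple 'rV[K]_3).

Definition dot u v : K := \sum_(i < 3) u 0 i * v 0 i.

(* The indices of the ordinals are taken in 'Z_3, so that the i-th coordinate
   is u_{i+1} v_{i+2} - u_{i+2} v_{i+1} with cyclic indices. *)
Definition cross u v : 'rV[K]_3 :=
  \row_(i < 3) (u 0 (i + 1) * v 0 (i + 2%:R) - u 0 (i + 2%:R) * v 0 (i + 1)).

(* Points of the projective plane are given by representing vectors; in
   particular u and v must be nonzero to represent points at all. *)
Definition proj_eq u v : Prop :=
  [/\ u != 0, v != 0 & exists k : K, u = k *: v].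

Definition aligned u v w : Prop :=
  exists2 l : 'rV[K]_3, l != 0 & [/\ dot l u = 0, dot l v = 0 & dot l w = 0].

(* The minor on columns j and k of the 2 x 3 matrix whose rows are the
   variables and the partial derivatives of f. *)
Definition eigen_minor f (j k : 'I_3) : {mpoly K[3]} :=
  'X_j * f^`M(k) - 'X_k * f^`M(j).

Definition eigenpoint f v : Prop :=
  v != 0 /\ forall j k : 'I_3, (eigen_minor f j k).@[v 0] = 0.

(* The ideal of K[x_0, x_1, x_2] generated by the minors and x_i - 1; the
   quotient by it is the coordinate ring of the affine open subscheme of E(f)
   where x_i != 0. *)
Definition eigen_chart f (i : 'I_3) (g : {mpoly K[3]}) : Prop :=
  exists (a : 'I_3 -> 'I_3 -> {mpoly K[3]}) (b : {mpoly K[3]}),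
    g = \sum_(j < 3) \sum_(k < 3) a j k * eigen_minor f j k + b * ('X_i - 1).

(* Reducedness and dimension are read off the cover of E(f) by its three
   standard affine charts. *)
Definition eigenscheme_reduced f : Prop :=
  forall i : 'I_3, radical_ideal (eigen_chart f i).

(* Krull dimension 0: there is a point, and no chain of primes of length 1. *)
Definition eigenscheme_dim0 f : Prop :=
  (exists (i : 'I_3) (p : {mpoly K[3]} -> Prop), prime_over (eigen_chart f i) p)
  /\ forall (i : 'I_3) (p q : {mpoly K[3]} -> Prop),
       prime_over (eigen_chart f i) p -> prime_over (eigen_chart f i) q ->
       (forall g, p g -> q g) -> forall g, q g -> p g.

Definition regular_form f : Prop :=
  eigenscheme_reduced f /\ eigenscheme_dim0 f.

(* The tuple P = [tuple P_1; ...; P_7] is indexed from 0. *)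
Definition C5_triples : seq (nat * nat * nat) :=
  [:: (1, 2, 3); (1, 4, 5); (1, 6, 7); (2, 4, 6)]%N.

Definition C5_configuration P : Prop :=
  (forall i j : 'I_7, i != j -> ~ proj_eq (tnth P i) (tnth P j))
  /\ forall i j k : 'I_7, (i.+1, j.+1, k.+1) \in C5_triples ->
       aligned (tnth P i) (tnth P j) (tnth P k).

Definition strict_C5_configuration P : Prop :=
  C5_configuration P
  /\ forall i j k : 'I_7, (i < j < k)%N ->
       aligned (tnth P i) (tnth P j) (tnth P k) ->
       (i.+1, j.+1, k.+1) \in C5_triples.

End ProjectivePlane.

(* Main.v *)
(* The third derivatives of f form a symmetric trilinear form T with
   T(v, v) = 2 grad f(v), so v is an eigenpoint iff T(v, v) is a multiple of v.
   Three aligned eigenpoints make T map their line to itself.  Hence T(P1, .)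
   preserves the three lines through P1, so it is scalar modulo P1, and by
   symmetry T(P1, w) = m w + c <P1, w> P1.  Let n be normal to the line P2P4P6,
   with <n, P1> = 1.  If Z = n - <n, n> P1 is nonzero, it is an eigenpoint on
   that line, hence one of P2, P4, P6.  The remaining eigenpoint on the line P1Z
   is then aligned with two others, which contradicts strictness.  So Z = 0, P1
   is orthogonal to P2, P4, P6 and m = 0.  It follows that P3, P5, P7 are
   l P1 + c <P1, P1> Q for Q = P2, P4, P6, where T(Q, Q) = l Q, and everything
   reduces to the eigenpoints P2, P4, P6 of the binary cubic induced by f on the
   plane orthogonal to P1. *)
Require Import Defs.
From HB Require Import structures.
From mathcomp Require Import all_boot all_order all_algebra.
From mathcomp Require Import reals complex.
From mathcomp Require Import mpoly.
From mathcomp Require Import ring.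

Set Implicit Arguments.
Unset Strict Implicit.
Unset Printing Implicit Defensive.

Import Order.TTheory GRing.Theory Num.Theory.
Local Open Scope ring_scope.

(** * Derivatives of homogeneous polynomials and Euler's identity *)

Section Euler.
Variables (n : nat) (A : comNzRingType).
Implicit Types p : {mpoly A[n]}.

Lemma dhomog_mderiv d p i : p \is d.+1.-homog -> p^`M(i) \is d.-homog.
Proof.
move=> /dhomogP hp; rewrite [p]mpolyE raddf_sum big_seq.
apply: rpred_sum => m mp.
(* When [m i] is 0 the truncated monomial has the wrong degree, but its coefficient vanishes. *)
rewrite /= mderivZ mderivX scalerA; have [->|mi0] := eqVneq (m i) 0%N.
  by rewrite mulr0 scale0r dhomog0.
apply/dhomogZ; rewrite dhomogX; apply/eqP/succn_inj.
by rewrite -(hp m mp) -addn1 -(mdeg1 i) -mdegD submK ?lep1mP.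
Qed.

Lemma euler_homog d p : p \is d.-homog -> \sum_i 'X_i * p^`M(i) = p *+ d.
Proof.
move=> /dhomogP hp; rewrite {2}[p]mpolyE -sumrMnl.
under eq_bigr do rewrite {1}[p]mpolyE raddf_sum mulr_sumr.
rewrite exchange_big; apply: eq_big_seq => m mp /=.
under eq_bigr do rewrite mderivZ mderivX scalerA -scalerAr.
transitivity (\sum_i (p@_m * (m i)%:R) *: 'X_[A, m]).
  apply: eq_bigr => i _; have [->|mi0] := eqVneq (m i) 0%N.
    by rewrite mulr0 !scale0r.
  by rewrite -mpolyXD addmC submK // lep1mP.
by rewrite -scaler_suml -mulr_sumr -natr_sum -mdegE hp // mulr_natr scalerMnl.
Qed.

End Euler.

(** * The symmetric trilinear form of a cubic *)

Section Polar.
Variable K : fieldType.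
Implicit Types (f : {mpoly K[3]}) (u v w : 'rV[K]_3).

(* Meant for cubic forms, whose third derivatives are constant: evaluating them
   at 0 loses nothing. *)
Definition polar f u v : 'rV[K]_3 :=
  \row_k \sum_(i < 3) \sum_(j < 3)
    u 0 i * v 0 j * (f^`M(k)^`M(i)^`M(j)).@[fun=> 0].

Lemma polarC f u v : polar f u v = polar f v u.
Proof.
apply/rowP => k; rewrite !mxE exchange_big; apply: eq_bigr => i _ /=.
by apply: eq_bigr => j _; rewrite mderiv_comm (mulrC (u 0 j)).
Qed.

Lemma polarDl f u v w : polar f (u + v) w = polar f u w + polar f v w.
Proof.
apply/rowP => k; rewrite !mxE -big_split; apply: eq_bigr => i _ /=.
by rewrite -big_split; apply: eq_bigr => j _; rewrite mxE !mulrDl.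
Qed.

Lemma polarZl f a u w : polar f (a *: u) w = a *: polar f u w.
Proof.
apply/rowP => k; rewrite !mxE mulr_sumr; apply: eq_bigr => i _ /=.
by rewrite mulr_sumr; apply: eq_bigr => j _; rewrite mxE !mulrA.
Qed.

Lemma polarDr f u v w : polar f w (u + v) = polar f w u + polar f w v.
Proof. by rewrite !(polarC _ w) polarDl. Qed.

Lemma polarZr f a u w : polar f w (a *: u) = a *: polar f w u.
Proof. by rewrite !(polarC _ w) polarZl. Qed.

(** Third partial derivatives commute, so the form is symmetric in all its arguments and each
    [polar f u] is self-adjoint for [dot]. *)
Lemma dot_polarC f u v w : dot (polar f u v) w = dot (polar f u w) v.
Proof.
transitivity (\sum_(k < 3) \sum_(i < 3) \sum_(j < 3)
    u 0 i * v 0 j * w 0 k * (f^`M(k)^`M(i)^`M(j)).@[fun=> 0]).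
  apply: eq_bigr => k _; rewrite mxE mulr_suml; apply: eq_bigr => i _.
  by rewrite mulr_suml; apply: eq_bigr => j _; rewrite mulrAC.
transitivity (\sum_(k < 3) \sum_(i < 3) \sum_(j < 3)
    u 0 i * v 0 k * w 0 j * (f^`M(k)^`M(i)^`M(j)).@[fun=> 0]).
  under eq_bigr do rewrite exchange_big.
  rewrite exchange_big; under eq_bigr do rewrite exchange_big.
  apply: eq_bigr => k _; apply: eq_bigr => i _; apply: eq_bigr => j _ /=.
  by rewrite mderiv_comm [in f^`M(_)^`M(k)]mderiv_comm mderiv_comm.
apply: eq_bigr => k _; rewrite mxE mulr_suml; apply: eq_bigr => i _.
by rewrite mulr_suml; apply: eq_bigr => j _; ring.
Qed.

(** Euler's identity is applied twice: to the first derivatives, of degree 2, whence the factor 2,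
    and to the second ones, of degree 1. *)
Lemma polar_grad f v k : f \is 3.-homog ->
  (f^`M(k)).@[v 0] *+ 2 = polar f v v 0 k.
Proof.
move=> hf; have hk : f^`M(k) \is 2.-homog by apply: dhomog_mderiv.
rewrite -mevalMn -(euler_homog hk) raddf_sum mxE; apply: eq_bigr => i _ /=.
have hi : f^`M(k)^`M(i) \is 1.-homog by apply: dhomog_mderiv.
rewrite mevalM mevalXU -{1}[_^`M(i)]mulr1n -(euler_homog hi) raddf_sum.
rewrite mulr_sumr.
apply: eq_bigr => j _ /=.
have /dhomogP h0 : f^`M(k)^`M(i)^`M(j) \is 0.-homog by apply: dhomog_mderiv.
rewrite mevalM mevalXU mulrA; congr (_ * _).
(* A form of degree 0 has only the constant monomial, so it takes the same value at [v] and at 0. *)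
rewrite !mevalE; apply: eq_big_seq => m /h0 /eqP; rewrite mdeg_eq0 => /eqP ->.
by rewrite !big1 // => l _; rewrite mnm0E expr0.
Qed.

(** By [polar_grad] the minors compare [v] with half of [polar f v v]; a nonzero coordinate of [v]
    supplies the factor of proportionality. *)
Lemma eigenpoint_polar f v : 2%:R != 0 :> K -> f \is 3.-homog ->
  eigenpoint f v <-> v != 0 /\ exists a, polar f v v = a *: v.
Proof.
move=> K2 hf; have gE k : (f^`M(k)).@[v 0] = polar f v v 0 k / 2%:R.
  by rewrite -polar_grad // -[in RHS]mulr_natr mulfK.
have mE j k : (eigen_minor f j k).@[v 0]
    = (v 0 j * polar f v v 0 k - v 0 k * polar f v v 0 j) / 2%:R.
  by rewrite mevalB !mevalM !mevalXU !gE; field.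
split=> -[v0]; last first.
  by case=> a fa; split=> // j k; rewrite mE fa !mxE; field.
move=> h; split=> //; have /rV0Pn[j vj] := v0.
exists (polar f v v 0 j / v 0 j); apply/rowP => k; rewrite [RHS]mxE.
have /eqP := h j k; rewrite mE mulf_eq0 invr_eq0 (negPf K2) orbF subr_eq0.
by move=> /eqP e; rewrite mulrAC [_ * v 0 k]mulrC -e mulrAC divff // mul1r.
Qed.

End Polar.

(** * Bilinear algebra of points and lines in the plane *)

Section Lines.
Variable K : fieldType.
Implicit Types (u v w z : 'rV[K]_3) (a b c : K).

Lemma dotC u v : dot u v = dot v u.
Proof. by apply: eq_bigr => i _; rewrite mulrC. Qed.

Lemma dotDl u v w : dot (u + v) w = dot u w + dot v w.
Proof. by rewrite -big_split; apply: eq_bigr => i _; rewrite mxE mulrDl. Qed.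

Lemma dotZl a u w : dot (a *: u) w = a * dot u w.
Proof. by rewrite mulr_sumr; apply: eq_bigr => i _; rewrite mxE mulrA. Qed.

Lemma dotDr u v w : dot w (u + v) = dot w u + dot w v.
Proof. by rewrite !(dotC w) dotDl. Qed.

Lemma dotZr a u w : dot w (a *: u) = a * dot w u.
Proof. by rewrite !(dotC w) dotZl. Qed.

Lemma dotNl u w : dot (- u) w = - dot u w.
Proof. by rewrite -scaleN1r dotZl mulN1r. Qed.

Lemma dotNr u w : dot w (- u) = - dot w u.
Proof. by rewrite !(dotC w) dotNl. Qed.

Lemma dot0l u : dot 0 u = 0.
Proof. by rewrite -(scale0r 0) dotZl mul0r. Qed.

Lemma dot0r u : dot u 0 = 0.
Proof. by rewrite dotC dot0l. Qed.

Definition dotE := (dotDl, dotDr, dotNl, dotNr, dotZl, dotZr, dot0l, dot0r).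

Lemma mulmx_tr_dot u v : u *m v^T = (dot u v)%:M.
Proof.
rewrite [LHS]mx11_scalar mxE; congr (_%:M).
by apply: eq_bigr => i _; rewrite mxE.
Qed.

Lemma scalar_mx11_eq0 a : ((a%:M : 'M_1) == 0) = (a == 0).
Proof.
apply/eqP/eqP => [/matrixP/(_ 0 0)|->]; last exact: raddf0.
by rewrite !mxE mulr1n.
Qed.

Lemma dot_eq1 u : u != 0 -> exists v, dot u v = 1.
Proof.
case/rV0Pn => i ui; exists ((u 0 i)^-1 *: delta_mx 0 i); rewrite dotZr.
rewrite /dot (bigD1 i) //= big1 ?addr0; last first.
  by move=> j /negPf ji; rewrite mxE ji andbF mulr0.
by rewrite mxE !eqxx mulr1 mulVf.
Qed.

Lemma ord3_ind (A : 'I_3 -> Prop) : A 0 -> A 1 -> A 2%:R -> forall i, A i.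
Proof.
move=> h0 h1 h2 [[|[|[|//]]] i3].
- by rewrite (_ : Ordinal i3 = 0) //; apply: val_inj.
- by rewrite (_ : Ordinal i3 = 1) //; apply: val_inj.
- by rewrite (_ : Ordinal i3 = 2%:R) //; apply: val_inj.
Qed.

Lemma dot_coords u v :
  dot u v = u 0 0 * v 0 0 + u 0 1 * v 0 1 + u 0 2%:R * v 0 2%:R.
Proof.
rewrite /dot !big_ord_recl big_ord0 addr0 addrA.
by congr (u 0 _ * v 0 _ + u 0 _ * v 0 _ + u 0 _ * v 0 _); apply: val_inj.
Qed.

Lemma cross_coords u v :
  [/\ cross u v 0 0 = u 0 1 * v 0 2%:R - u 0 2%:R * v 0 1,
      cross u v 0 1 = u 0 2%:R * v 0 0 - u 0 0 * v 0 2%:R &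
      cross u v 0 2%:R = u 0 0 * v 0 1 - u 0 1 * v 0 0].
Proof.
by split; rewrite mxE; congr (u 0 _ * v 0 _ - u 0 _ * v 0 _); apply: val_inj.
Qed.

Lemma dot_crossl u v : dot (cross u v) u = 0.
Proof. by rewrite dot_coords; have [-> -> ->] := cross_coords u v; ring. Qed.

Lemma dot_crossr u v : dot (cross u v) v = 0.
Proof. by rewrite dot_coords; have [-> -> ->] := cross_coords u v; ring. Qed.

Lemma cross_eq0 u v : cross u v = 0 -> v != 0 -> exists a, u = a *: v.
Proof.
move=> uv /rV0Pn[j vj]; exists (u 0 j / v 0 j); apply/rowP => i; rewrite mxE.
suff e : u 0 i * v 0 j = u 0 j * v 0 i by rewrite mulrAC -e mulfK.
have [] := cross_coords u v; rewrite uv !mxE => h0 h1 h2.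
move/esym/eqP: h0; move/esym/eqP: h1; move/esym/eqP: h2.
rewrite !subr_eq0 => /eqP h2 /eqP h1 /eqP h0 {vj}.
by move: i j; apply: ord3_ind; apply: ord3_ind.
Qed.

Let rows3 u v w : 'M[K]_3 := col_mx u (col_mx v w : 'M_(1 + 1, 3)).

(** Cutting [r] into its entries turns left kernel vectors of the matrix into linear relations
    between its rows. *)
Let mul_rows3 (r : 'rV[K]_3) u v w : exists a b c,
  (r == 0) = [&& a == 0, b == 0 & c == 0] /\
  r *m rows3 u v w = a *: u + b *: v + c *: w.
Proof.
move: r; rewrite /rows3 => r.
rewrite -[r](@hsubmxK _ 1 1 2) -[@rsubmx _ 1 1 2 r](@hsubmxK _ 1 1 1).
rewrite (mul_row_col (n1 := 1) (n2 := 2)) (mul_row_col (n1 := 1) (n2 := 1)).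
rewrite [lsubmx (rsubmx _)]mx11_scalar [rsubmx (rsubmx _)]mx11_scalar.
rewrite [@lsubmx _ 1 1 2 r]mx11_scalar !mul_scalar_mx addrA.
do 3!eexists; split; last reflexivity.
by rewrite (row_mx_eq0 (n1 := 1)) (row_mx_eq0 (n1 := 1)) !scalar_mx11_eq0.
Qed.

(** A line through the three points is a nonzero left kernel vector of the transposed matrix. *)
Lemma aligned_det u v w : aligned u v w <-> \det (rows3 u v w) = 0.
Proof.
rewrite -det_tr; split=> [[l l0 [lu lv lw]]|/eqP/det0P[l l0 e]].
  apply/eqP/det0P; exists l => //.
  rewrite /rows3 (tr_col_mx (m1 := 1)) (tr_col_mx (m1 := 1)).
  rewrite (mul_mx_row (p1 := 1)) (mul_mx_row (p1 := 1)).
  by rewrite !mulmx_tr_dot lu lv lw !raddf0 !row_mx0.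
exists l => //; move: e.
rewrite /rows3 (tr_col_mx (m1 := 1)) (tr_col_mx (m1 := 1)).
rewrite (mul_mx_row (p1 := 1)) (mul_mx_row (p1 := 1)) !mulmx_tr_dot.
move/eqP; rewrite (row_mx_eq0 (n1 := 1)) (row_mx_eq0 (n1 := 1)).
by rewrite !scalar_mx11_eq0 => /and3P[/eqP-> /eqP-> /eqP->].
Qed.

Lemma aligned_dep u v w : aligned u v w -> exists a b c,
  ~~ [&& a == 0, b == 0 & c == 0] /\ a *: u + b *: v + c *: w = 0.
Proof.
move/aligned_det/eqP/det0P => [r r0 e].
have [a [b [c [rE mE]]]] := mul_rows3 r u v w.
by exists a, b, c; rewrite -rE -mE.
Qed.

Lemma dep_aligned u v w a b c : ~~ [&& a == 0, b == 0 & c == 0] ->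
  a *: u + b *: v + c *: w = 0 -> aligned u v w.
Proof.
move=> abc e; apply/aligned_det/eqP/det0P.
exists (row_mx a%:M (row_mx b%:M c%:M : 'M_(1, 1 + 1))).
  rewrite (row_mx_eq0 (n1 := 1)) (row_mx_eq0 (n1 := 1)).
  by rewrite !scalar_mx11_eq0.
rewrite (mul_row_col (n1 := 1) (n2 := 2)) (mul_row_col (n1 := 1) (n2 := 1)).
by rewrite !mul_scalar_mx addrA.
Qed.

Lemma naligned_free u v w a b c : ~ aligned u v w ->
  a *: u + b *: v + c *: w = 0 -> [/\ a = 0, b = 0 & c = 0].
Proof.
move=> nal e; case: (boolP [&& a == 0, b == 0 & c == 0]).
  by case/and3P=> /eqP-> /eqP-> /eqP->.
by move/dep_aligned/(_ e).
Qed.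

Lemma naligned_span u v w z : ~ aligned u v w ->
  exists a b c, z = a *: u + b *: v + c *: w.
Proof.
move=> nal; have un : rows3 u v w \in unitmx.
  by rewrite unitmxE unitfE; apply/eqP => /aligned_det.
have [a [b [c [_ mE]]]] := mul_rows3 (z *m invmx (rows3 u v w)) u v w.
by exists a, b, c; rewrite -mE mulmxKV.
Qed.

Lemma naligned_orth u v w z : ~ aligned u v w ->
  dot z u = 0 -> dot z v = 0 -> dot z w = 0 -> z = 0.
Proof.
by move=> nal zu zv zw; apply/eqP/negPn/negP => z0; apply: nal; exists z.
Qed.

Lemma aligned213 u v w : aligned u v w -> aligned v u w.
Proof. by case=> l l0 [? ? ?]; exists l. Qed.

Lemma aligned132 u v w : aligned u v w -> aligned u w v.
Proof. by case=> l l0 [? ? ?]; exists l. Qed.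

Lemma proj_eq_sym u v : proj_eq u v -> proj_eq v u.
Proof.
case=> u0 v0 [k uE]; split=> //; exists k^-1.
rewrite uE scalerA mulVf ?scale1r //.
by apply: contraNneq u0 => k0; rewrite uE k0 scale0r.
Qed.

Lemma proj_eq_trans u v w : proj_eq u v -> proj_eq v w -> proj_eq u w.
Proof.
case=> u0 _ [a uE] [_ w0 [b vE]]; split=> //.
by exists (a * b); rewrite uE vE scalerA.
Qed.

Lemma proj_eq_free u v a b : u != 0 -> v != 0 -> ~ proj_eq u v ->
  a *: u + b *: v = 0 -> a = 0 /\ b = 0.
Proof.
move=> u0 v0 nuv e.
have a0 : a = 0.
  apply/eqP/negPn/negP => a0; apply: nuv; split=> //; exists (- (a^-1 * b)).
  apply: (scalerI a0); rewrite scalerA mulrN mulrA divff // mul1r scaleNr.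
  by apply/eqP; rewrite -addr_eq0 e.
split=> //; move/eqP: e; rewrite a0 scale0r add0r scaler_eq0 (negPf v0) orbF.
by move/eqP.
Qed.

Lemma proj_eq_free_inj u v a b a' b' : u != 0 -> v != 0 -> ~ proj_eq u v ->
  a *: u + b *: v = a' *: u + b' *: v -> a = a' /\ b = b'.
Proof.
move=> u0 v0 nuv /eqP; rewrite -subr_eq0 => /eqP e.
have [/subr0_eq -> /subr0_eq -> //] : a - a' = 0 /\ b - b' = 0.
apply: (proj_eq_free u0 v0 nuv); rewrite -e.
by apply/rowP => i; rewrite !mxE; ring.
Qed.

(** Distinct points admit no relation between just two of them, so every coefficient of the relation
    among the three is nonzero. *)
Lemma aligned_comb u v w : u != 0 -> v != 0 -> w != 0 ->
  ~ proj_eq u v -> ~ proj_eq u w -> ~ proj_eq v w -> aligned u v w ->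
  exists a b, [/\ a != 0, b != 0 & w = a *: u + b *: v].
Proof.
move=> u0 v0 w0 nuv nuw nvw /aligned_dep[a [b [c [abc e]]]].
have c0 : c != 0.
  apply: contraNneq abc => c0; move: e; rewrite c0 scale0r addr0.
  by case/(proj_eq_free u0 v0 nuv) => -> ->; rewrite eqxx.
have a0 : a != 0.
  apply: contraNneq c0 => a0; move: e; rewrite a0 scale0r add0r.
  by case/(proj_eq_free v0 w0 nvw) => _ ->.
have b0 : b != 0.
  apply: contraNneq c0 => b0; move: e; rewrite b0 scale0r addr0.
  by case/(proj_eq_free u0 w0 nuw) => _ ->.
exists (- a / c), (- b / c); split; rewrite ?mulf_neq0 ?oppr_eq0 ?invr_eq0 //.
apply: (scalerI c0); apply/eqP; rewrite -subr_eq0 -e; apply/eqP/rowP => i.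
by rewrite !mxE; field.
Qed.

End Lines.

(** * Eigenpoints on a line, when 2 is invertible *)

Section Eigenlines.
Variables (K : fieldType) (f : {mpoly K[3]}).
Hypothesis K2 : 2%:R != 0 :> K.
Local Notation T := (polar f).
Implicit Types (B D P Q u v w z n : 'rV[K]_3) (a b c m x y p q : K).

Definition polarE := (polarDl, polarDr, polarZl, polarZr).

(** Reduces a consequence of known equations to an identity between differences that [ring] or
    [field] can check. *)
Lemma eq_of_sub (V : zmodType) (r s t k : V) : r = s -> t - k = r - s -> t = k.
Proof. by move=> ->; rewrite subrr => /subr0_eq. Qed.

(** Expanding at [x *: u + y *: v] isolates [2 x y T u v]; all other terms lie in the span of [u]
    and [v]. *)
Lemma polar_chord u v a b c x y : x != 0 -> y != 0 ->
  T u u = a *: u -> T v v = b *: v ->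
  T (x *: u + y *: v) (x *: u + y *: v) = c *: (x *: u + y *: v) ->
  exists p q, T u v = p *: u + q *: v.
Proof.
move=> x0 y0 uu vv e.
exists ((c - x * a) / (2%:R * y)), ((c - y * b) / (2%:R * x)).
have xy0 : 2%:R * x * y != 0 by rewrite !mulf_neq0.
apply: (scalerI xy0).
have {e} -> : (2%:R * x * y) *: T u v
    = c *: (x *: u + y *: v) - (x ^+ 2 * a) *: u - (y ^+ 2 * b) *: v.
  rewrite -e !polarE uu vv (polarC f v u).
  by apply/rowP => i; rewrite !mxE; ring.
by apply/rowP => i; rewrite !mxE; field; rewrite y0 x0 K2.
Qed.

(** The last two equations make every [u + y *: v] an eigenvector. As at most three points of the
    line are eigenpoints, [u + v] and [u - v] would both represent [w]. *)
Lemma line_not_all_eigen u v w a b p q :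
  u != 0 -> v != 0 -> ~ proj_eq u v ->
  (forall z, z != 0 -> (exists c, T z z = c *: z) -> aligned u v z ->
     [\/ proj_eq z u, proj_eq z v | proj_eq z w]) ->
  T u u = a *: u -> T v v = b *: v -> T u v = p *: u + q *: v ->
  a = 2%:R * q -> b = 2%:R * p -> False.
Proof.
move=> u0 v0 nuv fin uu vv uv aq bp.
have free := proj_eq_free u0 v0 nuv.
have in_w y : y != 0 -> proj_eq (u + y *: v) w.
  move=> y0; case: (fin (u + y *: v)).
  - apply/eqP; rewrite -[u]scale1r => /free[/eqP].
    by rewrite oner_eq0.
  - exists (a + 2%:R * y * p); rewrite !polarE uu vv uv (polarC f v u) uv aq bp.
    by apply/rowP => i; rewrite !mxE; ring.
  - apply: (@dep_aligned _ _ _ _ 1 y (-1)).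
      by rewrite oner_eq0.
    by apply/rowP => i; rewrite !mxE; ring.
  - case=> _ _ [k e]; have [] : 1 - k = 0 /\ y = 0.
      apply: free; rewrite scalerBl scale1r addrAC e subrr //.
    by move=> _ y1; rewrite y1 eqxx in y0.
  - case=> _ _ [k e]; have [] : 1 = 0 :> K /\ y - k = 0.
      by apply: free; rewrite scalerBl scale1r addrA e subrr.
    by move/eqP; rewrite oner_eq0.
  - by [].
have [_ w0 [k ek]] := in_w 1 (oner_neq0 _).
have [_ _ [l el]] : proj_eq (u + (-1) *: v) w.
  by apply: in_w; rewrite oppr_eq0 oner_neq0.
(* Both [l (u + v)] and [k (u - v)] equal [k l w]. *)
have [/subr0_eq lk] : l - k = 0 /\ l + k = 0.
  apply: free; rewrite -[RHS](subrr (l *: (k *: w))).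
  rewrite -{1}ek scalerA mulrC -scalerA -el.
  by apply/rowP => i; rewrite !mxE; ring.
rewrite lk -mulr2n -mulr_natl => /eqP.
rewrite mulf_eq0 (negPf K2) /= => /eqP k0.
have [] : 1 = 0 :> K /\ 1 = 0 :> K.
  by apply: free; rewrite scale1r ek k0 scale0r.
by move/eqP; rewrite oner_eq0.
Qed.

(** On a spanning set [T P] is multiplication by [m] modulo [P], so [T P w = m w + d(w) P]. Symmetry
    against a vector [w0] with [dot P w0 = 1] forces [d(w) = d(w0) * dot P w]. *)
Lemma polar_vertex P u v m x p q :
  ~ aligned P u v -> P != 0 -> T P P = x *: P ->
  T P u = p *: P + m *: u -> T P v = q *: P + m *: v ->
  exists c, forall w, T P w = m *: w + (c * dot P w) *: P.
Proof.
move=> nal P0 PP Pu Pv.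
have mod_P w : exists d, T P w = m *: w + d *: P.
  have [a [b [c ->]]] := naligned_span w nal.
  exists (a * (x - m) + b * p + c * q); rewrite !polarE PP Pu Pv.
  by apply/rowP => i; rewrite !mxE; ring.
have [w0 Pw0] := dot_eq1 P0; have [c cE] := mod_P w0; exists c => w.
have [d dE] := mod_P w; rewrite dE.
have := dot_polarC f P w w0; rewrite dE cE !dotE Pw0 (dotC w0) mulr1.
by move/addrI ->.
Qed.

(** * A point [P] whose polar map is scalar modulo [P] *)

Section Vertex.
Variables (P : 'rV[K]_3) (m c : K).
Hypothesis PE : forall w, T P w = m *: w + (c * dot P w) *: P.

(** The coefficients of [P] and [Q] in the eigenvector equation give two expressions for [r];
    equating them leaves a linear condition on [x] and [y]. *)
Lemma second_eigenpoint Q x y l r :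
  P != 0 -> Q != 0 -> ~ proj_eq P Q -> x != 0 ->
  T Q Q = l *: Q ->
  T (x *: P + y *: Q) (x *: P + y *: Q) = r *: (x *: P + y *: Q) ->
  y != 0 -> x * (m - c * dot P P) = y * (2%:R * c * dot P Q - l).
Proof.
move=> P0 Q0 nPQ x0 QQ e y0.
have {e} [e1 e2] : r * x = x * (x * (m + c * dot P P) + 2%:R * y * c * dot P Q)
    /\ r * y = y * (2%:R * x * m + y * l).
  apply: (proj_eq_free_inj P0 Q0 nPQ).
  rewrite -!scalerA -scalerDr -e !polarE QQ (polarC f Q P) !PE.
  by apply/rowP => i; rewrite !mxE; ring.
rewrite mulrC in e1; rewrite mulrC in e2.
move: e1 (e2) => /(mulfI x0) -> /(mulfI y0) e.
by apply: (eq_of_sub (esym e)); ring.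
Qed.

(** Otherwise [second_eigenpoint] gives [l = 2 c * dot P Q], and the whole line [PQ] would consist
    of eigenpoints. *)
Lemma vertex_nondegenerate Q w x y l r :
  P != 0 -> Q != 0 -> ~ proj_eq P Q ->
  (forall z, z != 0 -> (exists c, T z z = c *: z) -> aligned P Q z ->
     [\/ proj_eq z P, proj_eq z Q | proj_eq z w]) ->
  x != 0 -> y != 0 -> T Q Q = l *: Q ->
  T (x *: P + y *: Q) (x *: P + y *: Q) = r *: (x *: P + y *: Q) ->
  m - c * dot P P != 0.
Proof.
move=> P0 Q0 nPQ fin x0 y0 QQ e; apply/eqP => mc.
have := second_eigenpoint P0 Q0 nPQ x0 QQ e y0.
rewrite mc mulr0 => /esym/eqP.
rewrite mulf_eq0 (negPf y0) /= subr_eq0 => /eqP lE.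
apply: (line_not_all_eigen (w := w) (p := c * dot P Q) (q := m)
  P0 Q0 nPQ fin _ QQ).
- by rewrite PE -scalerDl.
- by rewrite PE addrC.
- by move/subr0_eq: mc => <-; ring.
- by rewrite -lE mulrA.
Qed.

(** * A line with normal [n], stable under the polar form and missing [P] *)

Section Transversal.
Variable n : 'rV[K]_3.
Hypothesis nP : dot n P = 1.
Hypothesis n_line : forall u v, dot n u = 0 -> dot n v = 0 -> dot n (T u v) = 0.

(** Both sides pair equally with [P], [u] and [v]: stability of the line handles [u] and [v], and
    [PE] handles [P]. *)
Lemma polar_normal u v z : ~ aligned P u v ->
  dot n u = 0 -> dot n v = 0 -> dot n z = 0 -> T n z = (c * dot P z) *: n.
Proof.
move=> nal nu nv nz; apply/subr0_eq/(naligned_orth nal); rewrite !dotE.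
- rewrite nP polarC dot_polarC (polarC f z P) PE !dotE.
  by rewrite (dotC z) (dotC P n) nz nP mulr0 add0r subrr.
- by rewrite nu mulr0 subr0 polarC dot_polarC dotC n_line.
- by rewrite nv mulr0 subr0 polarC dot_polarC dotC n_line.
Qed.

(** If nonzero, this is the point where the line joining [P] and [n] meets the transversal; it is
    zero exactly when [n] is a multiple of [P]. *)
Definition foot := n - dot n n *: P.

Lemma dot_foot : dot n foot = 0.
Proof. by rewrite !dotE nP mulr1 subrr. Qed.

Variables (u0 v0 : 'rV[K]_3).
Hypothesis nal : ~ aligned P u0 v0.
Hypotheses (nu0 : dot n u0 = 0) (nv0 : dot n v0 = 0).

Lemma polar_foot w : dot n w = 0 ->
  T foot w = (c * dot P w) *: foot - (dot n n * m) *: w.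
Proof.
move=> nw; rewrite /foot -scaleNr !polarE PE (polar_normal nal nu0 nv0 nw).
by apply/rowP => i; rewrite !mxE; ring.
Qed.

Lemma foot_eigen : exists a, T foot foot = a *: foot.
Proof.
exists (c * dot P foot - dot n n * m).
by rewrite polar_foot ?dot_foot // scalerBl.
Qed.

(* Expanding [T foot B] and [T foot D] in the basis [B], [D] of the transversal
   determines [lD]; this is what locates the second eigenpoint on [PD]. *)
Lemma foot_aligned B D a b lB lD x y x' y' r r' :
  P != 0 -> foot != 0 -> B != 0 -> D != 0 ->
  ~ proj_eq P foot -> ~ proj_eq P D -> ~ proj_eq B D ->
  dot n B = 0 -> dot n D = 0 -> T B B = lB *: B -> T D D = lD *: D ->
  b != 0 -> foot = a *: B + b *: D ->
  x != 0 -> y != 0 -> x' != 0 -> y' != 0 ->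
  T (x *: P + y *: foot) (x *: P + y *: foot) = r *: (x *: P + y *: foot) ->
  T (x' *: P + y' *: D) (x' *: P + y' *: D) = r' *: (x' *: P + y' *: D) ->
  m - c * dot P P != 0 ->
  aligned (x *: P + y *: foot) B (x' *: P + y' *: D).
Proof.
move=> P0 Z0 B0 D0 nPZ nPD nBD nB nD BB DD b0 ZE x0 y0 x'0 y'0 eA eD k0.
have ZZ : T foot foot = (c * dot P foot - dot n n * m) *: foot.
  by rewrite polar_foot ?dot_foot // scalerBl.
have hA := second_eigenpoint P0 Z0 nPZ x0 ZZ eA y0.
have hD := second_eigenpoint P0 D0 nPD x'0 DD eD y'0.
have ZB := polar_foot nB; have ZD := polar_foot nD.
have sZ : dot P foot = a * dot P B + b * dot P D by rewrite ZE !dotE.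
have b_rel : b * (2%:R * c * dot P D - lD) = c * dot P foot + dot n n * m.
  (* Both sides equal [- (a b) T B D]. *)
  have e : b *: (b *: T D D - T foot D) = a *: (a *: T B B - T foot B).
    rewrite ZE !polarE (polarC f D B).
    by apply/rowP => i; rewrite !mxE; ring.
  have [_] : - (a * b * c * dot P D)
        = a ^+ 2 * (lB - c * dot P B) + a * (dot n n * m)
      /\ b * (b * (lD - c * dot P D) + dot n n * m) = b * - (a * c * dot P B).
    apply: (proj_eq_free_inj B0 D0 nBD); move: e.
    rewrite ZB ZD BB DD ZE => /eq_of_sub; apply.
    by apply/rowP => i; rewrite !mxE; ring.
  by move/(mulfI b0)/esym/eq_of_sub; apply; rewrite sZ; ring.
(* This equates the coefficients of [D], the only ones that do not cancel by themselves in the final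
   linear relation. *)
have key : x' * y * b = x * y'.
  apply: (mulIf k0).
  transitivity (y * b * (x' * (m - c * dot P P))); first by ring.
  transitivity (y' * (x * (m - c * dot P P))); last by ring.
  rewrite hA hD; apply: (eq_of_sub (congr1 ( *%R (y * y')) b_rel)).
  by rewrite /=; ring.
apply: (@dep_aligned _ _ _ _ x' (- (x' * y * a)) (- x)).
  by rewrite negb_and x'0.
rewrite ZE; apply: (eq_of_sub (congr1 ( *:%R^~ D) key)).
by apply/rowP => i; rewrite !mxE; ring.
Qed.

End Transversal.
End Vertex.
End Eigenlines.

(** * The binary cubic on the plane orthogonal to [P] *)

Section BinaryPart.
Variables (K : fieldType) (f : {mpoly K[3]}).
Hypothesis K2 : 2%:R != 0 :> K.
Local Notation T := (polar f).
Implicit Types (P u v w : 'rV[K]_3).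

(** [dot] may have isotropic vectors. If the Gram determinant is 0, then [<u,v> u - <u,u> v] is
    orthogonal to [P], [u], [v], hence 0; so [u] is orthogonal to all three as well. *)
Lemma gram_neq0 P u v : ~ aligned P u v -> dot P u = 0 -> dot P v = 0 ->
  dot u u * dot v v - dot u v ^+ 2 != 0.
Proof.
move=> nal Pu Pv; apply/eqP => g0.
have e : dot u v *: u + (- dot u u) *: v = 0.
  apply: (naligned_orth nal); rewrite !dotE ?(dotC _ P) ?Pu ?Pv; first by ring.
    by rewrite (dotC v u); ring.
  by apply: (eq_of_sub (esym g0)); ring.
have [_ uv0 /eqP] : [/\ 0 = 0 :> K, dot u v = 0 & - dot u u = 0].
  by apply: (naligned_free nal); rewrite scale0r add0r.
rewrite oppr_eq0 => /eqP uu0.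
have u0 : u = 0 by apply: (naligned_orth nal); rewrite // dotC.
by apply: nal; rewrite u0; apply: (@dep_aligned _ _ _ _ 0 1 0);
  rewrite ?oner_eq0 ?andbF // scaler0 !scale0r !addr0.
Qed.

(* The pairing is nondegenerate on the plane orthogonal to [P], so [T u v] is
   recovered from its pairings with [u] and [v]. *)
Lemma third_binary_eigenpoint P u v lu lv l a b :
  ~ aligned P u v -> dot P u = 0 -> dot P v = 0 ->
  T u u = lu *: u -> T v v = lv *: v -> a != 0 -> b != 0 ->
  T (a *: u + b *: v) (a *: u + b *: v) = l *: (a *: u + b *: v) ->
  let S := dot u u * dot v v + dot u v ^+ 2 in
  exists t, [/\ lv * S - 2%:R * lu * dot u v * dot v v = t * a,
    lu * S - 2%:R * lv * dot u u * dot u v = t * b &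
    t = 0 -> exists p q,
      [/\ T u v = p *: u + q *: v, lu = 2%:R * q & lv = 2%:R * p]].
Proof.
move=> nal Pu Pv uu vv a0 b0 e S.
have [p [q uv]] := polar_chord K2 a0 b0 uu vv e.
have g0 := gram_neq0 nal Pu Pv; set g := _ - _ in g0.
(* Self-adjointness gives a linear system for [p] and [q] with determinant [g]. *)
have r1 : p * dot u u + q * dot u v = lu * dot u v.
  by rewrite -[RHS]dotZl -uu dot_polarC uv !dotE (dotC v u).
have r2 : p * dot u v + q * dot v v = lv * dot u v.
  by rewrite [in RHS]dotC -[RHS]dotZl -vv dot_polarC (polarC f v u) uv !dotE.
have gp : lv * S - 2%:R * lu * dot u v * dot v v = g * (lv - 2%:R * p).
  apply: (eq_of_sub (congr2
    (fun r s => 2%:R * (dot v v * r - dot u v * s)) r1 r2)).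
  by rewrite /g /S /=; ring.
have gq : lu * S - 2%:R * lv * dot u u * dot u v = g * (lu - 2%:R * q).
  apply: (eq_of_sub (congr2
    (fun r s => 2%:R * (dot u u * s - dot u v * r)) r1 r2)).
  by rewrite /g /S /=; ring.
(* The coefficients of [u] and [v] in the eigenvector equation give two values of [l], equated
   here. *)
have ab : a * (lu - 2%:R * q) = b * (lv - 2%:R * p).
  have [_ eu ev] : [/\ 0 = 0 :> K, a * (l - (a * lu + 2%:R * b * p)) = 0
      & b * (l - (b * lv + 2%:R * a * q)) = 0].
    apply: (naligned_free nal); rewrite scale0r add0r.
    move/esym: e; rewrite !polarE uu vv (polarC f v u) uv => /eq_of_sub; apply.
    by apply/rowP => i; rewrite !mxE; ring.
  have {eu} /eqP := eu; rewrite mulf_eq0 (negPf a0) /= => /eqP eu.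
  have {ev} /eqP := ev; rewrite mulf_eq0 (negPf b0) /= => /eqP ev.
  by apply: (eq_of_sub (etrans ev (esym eu))); ring.
(* By [ab] this is also [g (lv - 2 p) / a]. *)
exists (g * (lu - 2%:R * q) / b); split.
- rewrite gp; apply: (mulIf b0).
  by apply: (eq_of_sub (congr1 ( *%R (- g)) ab)) => /=; field.
- by rewrite gq divfK.
move/eqP; rewrite !mulf_eq0 invr_eq0 (negPf b0) (negPf g0) orbF /= => luq.
exists p, q; split => //; apply/eqP; rewrite -subr_eq0 //.
by move/eqP: ab; rewrite (eqP luq) mulr0 eq_sym mulf_eq0 (negPf b0).
Qed.

(** Obtained by eliminating [t] from [third_binary_eigenpoint]. *)
Lemma binary_eigenvalues P u v w lu lv l a b :
  ~ aligned P u v -> dot P u = 0 -> dot P v = 0 ->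
  T u u = lu *: u -> T v v = lv *: v -> T w w = l *: w ->
  a != 0 -> b != 0 -> w = a *: u + b *: v ->
  lu * (dot u w * dot v v + dot v w * dot u v)
  = lv * (dot u w * dot u v + dot v w * dot u u).
Proof.
move=> nal Pu Pv uu vv ww a0 b0 wE; rewrite {}wE in ww *.
have [t [ta tb _]] := third_binary_eigenpoint nal Pu Pv uu vv a0 b0 ww.
apply: (eq_of_sub (congr2 (fun r s => a * s - b * r) ta tb)).
by rewrite /= !dotE (dotC v u); ring.
Qed.

End BinaryPart.

(** * The strict configuration of seven eigenpoints *)

Section C5.
Variables (K : fieldType) (f : {mpoly K[3]}) (P : 7.-tuple 'rV[K]_3).
Hypothesis K2 : 2%:R != 0 :> K.
Hypothesis f_cubic : f \is 3.-homog.
Hypothesis P_neq0 : forall i, tnth P i != 0.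
Hypothesis P_eigen : forall v,
  eigenpoint f v <-> exists i, proj_eq v (tnth P i).
Hypothesis P_C5 : strict_C5_configuration P.

Local Notation T := (polar f).
Implicit Types i j k : 'I_7.
Local Notation ord7 k := (@Ordinal 7 k isT).
Local Notation P1 := (tnth P (ord7 0)).
Local Notation P2 := (tnth P (ord7 1)).
Local Notation P3 := (tnth P (ord7 2)).
Local Notation P4 := (tnth P (ord7 3)).
Local Notation P5 := (tnth P (ord7 4)).
Local Notation P6 := (tnth P (ord7 5)).
Local Notation P7 := (tnth P (ord7 6)).

Lemma C5_neq i j : i != j -> ~ proj_eq (tnth P i) (tnth P j).
Proof. exact: P_C5.1.1. Qed.

Lemma C5_aligned i j k : (i.+1, j.+1, k.+1) \in C5_triples ->
  aligned (tnth P i) (tnth P j) (tnth P k).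
Proof. exact: P_C5.1.2. Qed.

Lemma C5_polar i : exists a, T (tnth P i) (tnth P i) = a *: tnth P i.
Proof.
have : eigenpoint f (tnth P i).
  by apply/P_eigen; exists i; split=> //; exists 1; rewrite scale1r.
by case/(eigenpoint_polar _ K2 f_cubic).
Qed.

(** Sorting the indices frees strictness from their order; for concrete indices the resulting
    boolean computes, which refutes forbidden alignments. *)
Lemma C5_strict i j k : aligned (tnth P i) (tnth P j) (tnth P k) ->
  [|| i == j, i == k, j == k | has (fun t =>
    perm_eq [:: i.+1; j.+1; k.+1] [:: t.1.1; t.1.2; t.2]) C5_triples].
Proof.
have sorted (a b c : 'I_7) : (a < b)%N -> (b < c)%N ->
    aligned (tnth P a) (tnth P b) (tnth P c) ->
    perm_eq [:: i.+1; j.+1; k.+1] [:: a.+1; b.+1; c.+1] ->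
    has (fun t => perm_eq [:: i.+1; j.+1; k.+1] [:: t.1.1; t.1.2; t.2])
      C5_triples.
  move=> ab bc al pe; apply/hasP; exists (a.+1, b.+1, c.+1) => //.
  by apply: P_C5.2; rewrite ?ab.
rewrite -!val_eqE; case: (ltngtP i j) => //= ij; case: (ltngtP j k) => //= jk;
  case: (ltngtP i k) => //= ik al.
- exact: (sorted i j k).
- by have := ltn_trans (ltn_trans ij jk) ik; rewrite ltnn.
- apply: (sorted i k j) => //; first exact: aligned132.
  by apply/permP => p /=; ring.
- apply: (sorted k i j) => //; first exact/aligned213/aligned132.
  by apply/permP => p /=; ring.
- apply: (sorted j i k) => //; first exact: aligned213.
  by apply/permP => p /=; ring.
- apply: (sorted j k i) => //; first exact/aligned132/aligned213.
  by apply/permP => p /=; ring.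
- by have := ltn_trans (ltn_trans jk ij) ik; rewrite ltnn.
- apply: (sorted k j i) => //; first exact/aligned213/aligned132/aligned213.
  by apply/permP => p /=; ring.
Qed.

(** An eigenpoint is one of the seven, and strictness leaves only the three of the given triple. *)
Lemma C5_eigen_on_line i j k v : (i.+1, j.+1, k.+1) \in C5_triples ->
  v != 0 -> (exists a, T v v = a *: v) -> aligned (tnth P i) (tnth P j) v ->
  [\/ proj_eq v (tnth P i), proj_eq v (tnth P j) | proj_eq v (tnth P k)].
Proof.
move=> ijk v0 ev al.
have /P_eigen[e ve] : eigenpoint f v by apply/(eigenpoint_polar _ K2 f_cubic).
have {al} : aligned (tnth P i) (tnth P j) (tnth P e).
  have [_ _ [c e_v]] := proj_eq_sym ve.
  by case: al => l l0 [li lj lv]; exists l; rewrite // e_v dotZr lv mulr0.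
move/C5_strict.
case: i ijk => i i7; case: j => j j7; case: k => k k7; rewrite !inE /=.
case: e ve => [[|[|[|[|[|[|[|//]]]]]]] e7] ve;
  case/or4P => /eqP[ei ej ek]; subst i j k; move=> h //.
all: first [ by constructor 1; rewrite (bool_irrelevance i7 e7)
  | by constructor 2; rewrite (bool_irrelevance j7 e7)
  | by constructor 3; rewrite (bool_irrelevance k7 e7)].
Qed.

Lemma C5_uniq i j k : (i.+1, j.+1, k.+1) \in C5_triples -> uniq [:: i; j; k].
Proof.
have /allP h : all (fun t => uniq [:: t.1.1; t.1.2; t.2]) C5_triples by [].
by move/h; rewrite /= !inE !eqSS !val_eqE.
Qed.

Lemma C5_comb i j k : uniq [:: i; j; k] ->
  aligned (tnth P i) (tnth P j) (tnth P k) ->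
  exists a b, [/\ a != 0, b != 0 & tnth P k = a *: tnth P i + b *: tnth P j].
Proof.
rewrite /= !inE negb_or andbT => /andP[/andP[ij ik] jk].
by apply: aligned_comb => //; apply: C5_neq.
Qed.

Lemma C5_chord i j k : uniq [:: i; j; k] ->
  aligned (tnth P i) (tnth P j) (tnth P k) ->
  exists p q, T (tnth P i) (tnth P j) = p *: tnth P i + q *: tnth P j.
Proof.
move=> uijk /(C5_comb uijk)[a [b [a0 b0 kE]]].
have [x xE] := C5_polar i; have [y yE] := C5_polar j.
by have [z] := C5_polar k; rewrite kE => /(polar_chord K2 a0 b0 xE yE).
Qed.

(** By [C5_chord], [T P1] preserves the lines to [P2], [P4] and [P6]. Since [P6] is a combination of
    [P2] and [P4] with nonzero coefficients, the three scalars modulo [P1] agree. *)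
Lemma C5_vertex :
  exists m c, forall w, T P1 w = m *: w + (c * dot P1 w) *: P1.
Proof.
have nal : ~ aligned P1 P2 P4 by move/C5_strict.
have [p2 [m e2]] : exists p q, T P1 P2 = p *: P1 + q *: P2.
  by apply: (@C5_chord _ _ (ord7 2)) => //; apply: C5_aligned.
have [p4 [m4 e4]] : exists p q, T P1 P4 = p *: P1 + q *: P4.
  by apply: (@C5_chord _ _ (ord7 4)) => //; apply: C5_aligned.
have [p6 [m6 e6]] : exists p q, T P1 P6 = p *: P1 + q *: P6.
  by apply: (@C5_chord _ _ (ord7 6)) => //; apply: C5_aligned.
have [a [b [a0 b0 E6]]] : exists a b,
    [/\ a != 0, b != 0 & P6 = a *: P2 + b *: P4].
  by apply: C5_comb => //; apply: C5_aligned.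
have [x ex] := C5_polar (ord7 0).
have [_ /eqP] : [/\ a * p2 + b * p4 - p6 = 0, a * (m - m6) = 0
    & b * (m4 - m6) = 0].
  apply: (naligned_free nal).
  move: e6; rewrite E6 !polarE e2 e4 => /eq_of_sub; apply.
  by apply/rowP => i; rewrite !mxE; ring.
rewrite mulf_eq0 (negPf a0) subr_eq0 /= => /eqP m6E.
move/eqP; rewrite mulf_eq0 (negPf b0) subr_eq0 /= => /eqP m4E.
exists m; apply: (polar_vertex nal _ ex e2); first exact: P_neq0.
by rewrite e4 m4E -m6E.
Qed.

(** * The normal of the line [P2P4P6], scaled so that it pairs to 1 with [P1] *)

Section Normal.
Variables (m c : K) (n : 'rV[K]_3).
Hypothesis PE : forall w, T P1 w = m *: w + (c * dot P1 w) *: P1.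
Hypotheses (n1 : dot n P1 = 1) (n2 : dot n P2 = 0) (n4 : dot n P4 = 0).

Lemma C5_vertex_nondegenerate : m - c * dot P1 P1 != 0.
Proof.
have [x [y [x0 y0 E3]]] : exists x y,
    [/\ x != 0, y != 0 & P3 = x *: P1 + y *: P2].
  by apply: C5_comb => //; apply: C5_aligned.
have [l e2] := C5_polar (ord7 1).
have [r] := C5_polar (ord7 2); rewrite E3 => e3.
apply: (vertex_nondegenerate (w := P3) K2 PE _ _ _ _ x0 y0 e2 e3) => //.
  exact: C5_neq.
by move=> z; apply: C5_eigen_on_line.
Qed.

(** The third eigenpoint [P6] puts [T P2 P4] in the span of [P2] and [P4]. *)
Lemma C5_polar_orth u v : dot n u = 0 -> dot n v = 0 -> dot n (T u v) = 0.
Proof.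
have nal : ~ aligned P1 P2 P4 by move/C5_strict.
have span w : dot n w = 0 -> exists y z, w = y *: P2 + z *: P4.
  have [x [y [z ->]]] := naligned_span w nal.
  rewrite !dotE n1 n2 n4 !mulr0 mulr1 !addr0 => ->.
  by exists y, z; rewrite scale0r add0r.
move=> /span[y [z ->]] /span[y' [z' ->]].
have [a e2] := C5_polar (ord7 1); have [b e4] := C5_polar (ord7 3).
have [p [q e24]] : exists p q, T P2 P4 = p *: P2 + q *: P4.
  by apply: (@C5_chord _ _ (ord7 5)) => //; apply: C5_aligned.
rewrite !polarE (polarC f P4 P2) e2 e4 e24 !dotE n2 n4; ring.
Qed.

(** Meant for [i], [j], [k] a reordering of the indices of [P2], [P4], [P6], so that the resulting
    alignment contradicts strictness. *)
Lemma C5_foot_aligned i j k i' k' :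
  (1, i.+1, i'.+1)%N \in C5_triples -> (1, k.+1, k'.+1)%N \in C5_triples ->
  uniq [:: j; k; i] -> aligned (tnth P j) (tnth P k) (tnth P i) ->
  dot n (tnth P j) = 0 -> dot n (tnth P k) = 0 ->
  proj_eq (foot P1 n) (tnth P i) ->
  aligned (tnth P i') (tnth P j) (tnth P k').
Proof.
move=> al_i al_k ujki al nj nk fi; have [f0 Pi0 [t footE]] := fi.
have t0 : t != 0 by apply: contraNneq f0 => t0; rewrite footE t0 scale0r.
have ui := @C5_uniq (ord7 0) _ _ al_i; have uk := @C5_uniq (ord7 0) _ _ al_k.
have [a [b [a0 b0 Ei]]] := C5_comb ujki al.
have [x [y [x0 y0 Ei']]] := C5_comb ui (C5_aligned (i := ord7 0) al_i).
have [x' [y' [x'0 y'0 Ek']]] := C5_comb uk (C5_aligned (i := ord7 0) al_k).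
have [lj ej] := C5_polar j; have [lk ek] := C5_polar k.
have [r] := C5_polar i'; have [r'] := C5_polar k'.
(* The foot is [t] times the representing vector of index [i], so its coefficient is divided by
   [t]. *)
have {}Ei' : tnth P i' = x *: P1 + (y / t) *: foot P1 n.
  by rewrite footE scalerA divfK.
rewrite Ek' Ei' => ek' ei'.
have nal : ~ aligned P1 P2 P4 by move/C5_strict.
apply: (foot_aligned PE n1 C5_polar_orth nal n2 n4 (b := t * b) (a := t * a)
    _ _ _ _ _ _ _ nj nk ej ek _ _ x0 _ x'0 y'0 ei' ek') => //.
- move/proj_eq_trans/(_ fi); apply: C5_neq.
  by move: ui; rewrite /= inE negb_or => /andP[/andP[]].
- by apply: C5_neq; move: uk; rewrite /= inE negb_or => /andP[/andP[]].
- by apply: C5_neq; move: ujki; rewrite /= inE negb_or => /andP[/andP[]].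
- by rewrite mulf_neq0.
- by rewrite footE Ei scalerDr !scalerA.
- by rewrite mulf_neq0 ?invr_eq0.
- exact: C5_vertex_nondegenerate.
Qed.

Lemma C5_foot0 : foot P1 n = 0.
Proof.
have nal : ~ aligned P1 P2 P4 by move/C5_strict.
apply/eqP/negPn/negP => f0.
have al246 : aligned P2 P4 P6 by apply: C5_aligned.
have n6 : dot n P6 = 0.
  have [|a [b [_ _ ->]]] := C5_comb _ al246; first by [].
  by rewrite !dotE n2 n4 !mulr0 addr0.
case: (@C5_eigen_on_line (ord7 1) (ord7 3) (ord7 5) (foot P1 n)) => //.
- exact: (foot_eigen PE n1 C5_polar_orth nal n2 n4).
- exists n; last by rewrite dot_foot.
  by apply/eqP => n0; move/eqP: n1; rewrite n0 dot0l eq_sym oner_eq0.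
- move=> fe; suff /C5_strict : aligned P3 P4 P7 by [].
  by apply: (C5_foot_aligned _ _ _ _ n4 n6 fe) => //;
    apply/aligned132/aligned213.
- move=> fe; suff /C5_strict : aligned P5 P2 P7 by [].
  by apply: (C5_foot_aligned _ _ _ _ n2 n6 fe) => //; apply/aligned132.
- move=> fe; suff /C5_strict : aligned P7 P4 P3 by [].
  by apply: (C5_foot_aligned _ _ _ _ n4 n2 fe) => //; apply/aligned213.
Qed.

End Normal.

(** Since the foot is 0, [n = <n,n> P1]: thus [P1] has the direction of [cross P2 P4] and is
    orthogonal to [P2] and [P4]. *)
Lemma C5_orthogonal : [/\ proj_eq P1 (cross P2 P4), dot P1 P2 = 0,
  dot P1 P4 = 0 & exists c,
    c * dot P1 P1 != 0 /\ forall w, T P1 w = (c * dot P1 w) *: P1].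
Proof.
have nal : ~ aligned P1 P2 P4 by move/C5_strict.
pose nu := cross P2 P4.
have nu0 : nu != 0.
  apply/eqP => /cross_eq0/(_ (P_neq0 _)) e24.
  by apply: (@C5_neq (ord7 1) (ord7 3)); rewrite //; split.
have nu1 : dot nu P1 != 0.
  apply/eqP => nu1; move/eqP: nu0; apply.
  by apply: (naligned_orth nal) => //; [apply: dot_crossl|apply: dot_crossr].
pose n := (dot nu P1)^-1 *: nu.
have n1 : dot n P1 = 1 by rewrite dotZl mulVf.
have n2 : dot n P2 = 0 by rewrite dotZl dot_crossl mulr0.
have n4 : dot n P4 = 0 by rewrite dotZl dot_crossr mulr0.
have [m [c PE]] := C5_vertex.
have k0 := C5_vertex_nondegenerate PE.
have /subr0_eq nE := C5_foot0 PE n1 n2 n4.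
have N0 : dot n n != 0.
  apply/eqP => N0; move/eqP: n1; rewrite nE N0 scale0r dot0l eq_sym.
  by rewrite oner_eq0.
have s2 : dot P1 P2 = 0.
  by apply: (mulfI N0); rewrite mulr0 -dotZl -nE.
have s4 : dot P1 P4 = 0.
  by apply: (mulfI N0); rewrite mulr0 -dotZl -nE.
(* [T n P2] is 0 by [polar_normal], but equals [<n,n> m P2] because [n] is a multiple of [P1]. *)
have m0 : m = 0.
  have := polar_normal PE n1 (C5_polar_orth n1 n2 n4) nal n2 n4 n2.
  rewrite s2 mulr0 scale0r nE polarZl PE s2 mulr0 scale0r addr0.
  move/eqP; rewrite !scaler_eq0 (negPf N0) (negPf (P_neq0 _)) orbF.
  by move/eqP.
split=> //; last first.
  exists c; split; first by rewrite m0 sub0r oppr_eq0 in k0.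
  by move=> w; rewrite PE m0 scale0r add0r.
split=> //; exists ((dot n n)^-1 * (dot nu P1)^-1).
by rewrite -scalerA -/n nE scalerA -nE mulVf ?scale1r.
Qed.

(** With [m = 0] and orthogonality, [second_eigenpoint] reads [x c <P1,P1> = y l]; as [x] is
    nonzero, so is [l]. *)
Lemma C5_second i j c l : (forall w, T P1 w = (c * dot P1 w) *: P1) ->
  c * dot P1 P1 != 0 -> dot P1 (tnth P i) = 0 ->
  T (tnth P i) (tnth P i) = l *: tnth P i ->
  (1, i.+1, j.+1)%N \in C5_triples -> exists y,
    [/\ y != 0, l != 0 &
      tnth P j = (y * l / (c * dot P1 P1)) *: P1 + y *: tnth P i].
Proof.
move=> PE k0 s1i ei ijk; have u := @C5_uniq (ord7 0) _ _ ijk.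
have [x [y [x0 y0 Ej]]] := C5_comb u (C5_aligned (i := ord7 0) ijk).
have [r] := C5_polar j; rewrite Ej => er.
have PE0 w : T P1 w = 0 *: w + (c * dot P1 w) *: P1.
  by rewrite PE scale0r add0r.
have n1i : ~ proj_eq P1 (tnth P i).
  by apply: C5_neq; move: u; rewrite /= inE negb_or => /andP[/andP[]].
have := second_eigenpoint PE0 (P_neq0 _) (P_neq0 _) n1i x0 ei er y0.
rewrite s1i mulr0 !sub0r !mulrN => /oppr_inj xk.
have xE : x = y * l / (c * dot P1 P1) by rewrite -xk mulfK.
exists y; split=> //; last by rewrite -xE.
by apply: contraNneq x0 => l0; rewrite xE l0 mulr0 mul0r.
Qed.

Local Notation s := (@dot K).

(** Substituting [C5_second] for [P3], [P5], [P7] turns each formula into a nonzero multiple of a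
    relation between eigenvalues on the plane orthogonal to [P1]. *)
Lemma C5_eigenpoints :
  [/\ proj_eq P1 (cross P2 P4),
      s P2 P6 * (s P4 P5 * s P1 P3 - s P3 P4 * s P1 P5)
        + s P4 P6 * (s P2 P5 * s P1 P3 - s P2 P3 * s P1 P5) = 0,
      proj_eq P6
        ((s P1 P5 * s P2 P4 * s P3 P4 + s P1 P5 * s P2 P3 * s P4 P4
            - s P1 P3 * s P2 P5 * s P4 P4 - s P1 P3 * s P2 P4 * s P4 P5) *: P2
         + (s P1 P3 * s P2 P4 * s P2 P5 - 2%:R * s P1 P5 * s P2 P2 * s P3 P4
            + s P1 P3 * s P2 P2 * s P4 P5) *: P4)
    & proj_eq P7
        ((s P2 P6 * s P1 P5 * s P4 P6 + s P2 P4 * s P1 P5 * s P6 P6) *: P1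
         + (s P1 P1 * (s P2 P6 * s P4 P5 + s P2 P4 * s P5 P6)) *: P6)].
Proof.
have [P1E s12 s14 [c [k0 PE]]] := C5_orthogonal.
have n124 : ~ aligned P1 P2 P4 by move/C5_strict.
have n126 : ~ aligned P1 P2 P6 by move/C5_strict.
have n164 : ~ aligned P1 P6 P4 by move/C5_strict.
have al246 : aligned P2 P4 P6 by apply: C5_aligned.
have [|a [b [a0 b0 E6]]] := C5_comb _ al246; first by [].
(* Seeing [P2] as the third point beside [P6] and [P4] gives a relation between [l6] and [l4],
   needed for [P7]. *)
have [||a' [b' [a'0 b'0 E2]]] := @C5_comb (ord7 5) (ord7 3) (ord7 1).
- by [].
- exact/aligned132/aligned213/aligned132.
have s16 : s P1 P6 = 0 by rewrite E6 !dotE s12 s14 !mulr0 addr0.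
have [l2 e2] := C5_polar (ord7 1); have [l4 e4] := C5_polar (ord7 3).
have [l6 e6] := C5_polar (ord7 5).
have [|y3 [y30 l20 E3]] := C5_second (j := ord7 2) PE k0 s12 e2; first by [].
have [|y5 [y50 l40 E5]] := C5_second (j := ord7 4) PE k0 s14 e4; first by [].
have [|y7 [y70 l60 E7]] := C5_second (j := ord7 6) PE k0 s16 e6; first by [].
have b24 := binary_eigenvalues K2 n124 s12 s14 e2 e4 e6 a0 b0 E6.
have b64 := binary_eigenvalues K2 n164 s16 s14 e6 e4 e2 a'0 b'0 E2.
have s11 : s P1 P1 != 0 by apply: contraNneq k0 => ->; rewrite mulr0.
have c0 : c != 0 by apply: contraNneq k0 => ->; rewrite mul0r.
have sC := (dotC P4 P2, dotC P6 P2, dotC P6 P4,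
            dotC P2 P1, dotC P4 P1, dotC P6 P1).
(* The common factor that the pairings with [P3] and [P5] bring out. *)
pose h := y3 * y5 / c.
have h0 : h != 0 by rewrite !mulf_neq0 ?invr_eq0.
split=> //.
- rewrite E3 E5 !dotE ?sC s12 s14.
  apply: (eq_of_sub (congr1 ( *%R h) b24)); rewrite /h /= ?sC.
  by field; rewrite s11 c0.
- have e6' := e6; rewrite E6 in e6'.
  have [t [ta tb t_eq0]] :=
    third_binary_eigenpoint K2 n124 s12 s14 e2 e4 a0 b0 e6'.
  (* If [t] were 0, every point of the line [P2P4] would be an eigenpoint. *)
  have t0 : t != 0.
    apply/eqP => /t_eq0[p [q [e24 l2q l4p]]].
    apply: (line_not_all_eigen K2 (w := P6) _ _ _ _ e2 e4 e24 l2q l4p) => //.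
      exact: C5_neq.
    by move=> z; apply: C5_eigen_on_line.
  have scaled : h * t *: P6 = (h * (t * a)) *: P2 + (h * (t * b)) *: P4.
    by rewrite E6; apply/rowP => i; rewrite !mxE; ring.
  set v := (X in proj_eq _ X).
  have vE : v = (h * t) *: P6.
    rewrite scaled -ta -tb /v; congr (_ *: _ + _ *: _);
      rewrite E3 E5 !dotE ?sC s12 s14 /h; field; by rewrite s11 c0.
  have ht0 : h * t != 0 by rewrite mulf_neq0.
  split=> //; first by rewrite vE scaler_eq0 negb_or ht0 P_neq0.
  by exists (h * t)^-1; rewrite vE scalerA mulVf ?scale1r.
- set v := (X in proj_eq _ X).
  rewrite !sC in b64; pose B := s P2 P6 * s P4 P4 + s P2 P4 * s P4 P6.
  (* If [B = 0], then since [l4] is nonzero [b64] and [b24] make [s46 P2 + s24 P6] orthogonal to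
     [P1], [P2], [P6], hence 0. So [s46 = s24 = 0], and [P4] would be orthogonal to the same three
     points. *)
  have B0 : B != 0.
    apply/eqP => B0.
    have C0 : s P2 P6 * s P4 P6 + s P2 P4 * s P6 P6 = 0.
      by apply: (mulfI l40); rewrite mulr0 -b64 -/B B0 mulr0.
    have D0 : s P2 P6 * s P2 P4 + s P4 P6 * s P2 P2 = 0.
      apply: (mulfI l40); rewrite mulr0 -b24 -(mulr0 l2) -B0 /B; by ring.
    have e : s P4 P6 *: P2 + s P2 P4 *: P6 = 0.
      apply: (naligned_orth n126); rewrite !dotE.
      - by rewrite ?sC s12 s16 !mulr0 addr0.
      - by rewrite -D0 ?sC; ring.
      - by rewrite -C0 ?sC; ring.
    have [_ s46 s24] : [/\ 0 = 0 :> K, s P4 P6 = 0 & s P2 P4 = 0].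
      by apply: (naligned_free n126); rewrite scale0r add0r.
    move/eqP: (P_neq0 (ord7 3)); apply; apply: (naligned_orth n126) => //.
      by rewrite dotC.
    by rewrite dotC.
  have g0 : y5 * s P1 P1 * B / y7 != 0.
    by rewrite !mulf_neq0 ?invr_eq0.
  have vE : v = (y5 * s P1 P1 * B / y7) *: P7.
    rewrite E7 scalerDr !scalerA /v; congr (_ *: _ + _ *: _).
      rewrite E5 !dotE ?sC s14 /B.
      apply: (eq_of_sub (congr1 ( *%R (- (y5 / c))) b64)) => /=.
      by field; rewrite y70 c0 s11.
    by rewrite E5 !dotE ?sC s14 s16 /B; field; rewrite y70 c0 s11.
  split=> //; first by rewrite vE scaler_eq0 negb_or g0 P_neq0.
  by exists (y5 * s P1 P1 * B / y7)^-1; rewrite vE scalerA mulVf ?scale1r.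
Qed.

End C5.

Theorem proposition7p3 (R : realType) (f : {mpoly (complex R)[3]})
    (P1 P2 P3 P4 P5 P6 P7 : 'rV[complex R]_3)
    (P := [tuple P1; P2; P3; P4; P5; P6; P7])
    (s := @dot (complex R))
    (f_neq0 : f != 0) (f_cubic : f \is 3.-homog)
    (f_regular : regular_form f)
    (P_neq0 : forall i : 'I_7, tnth P i != 0)
    (P_eigen : forall v : 'rV[complex R]_3,
       eigenpoint f v <-> exists i : 'I_7, proj_eq v (tnth P i))
    (P_C5 : strict_C5_configuration P) :
  [/\ proj_eq P1 (cross P2 P4),
      s P2 P6 * (s P4 P5 * s P1 P3 - s P3 P4 * s P1 P5)
        + s P4 P6 * (s P2 P5 * s P1 P3 - s P2 P3 * s P1 P5) = 0,
      proj_eq P6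
        ((s P1 P5 * s P2 P4 * s P3 P4 + s P1 P5 * s P2 P3 * s P4 P4
            - s P1 P3 * s P2 P5 * s P4 P4 - s P1 P3 * s P2 P4 * s P4 P5) *: P2
         + (s P1 P3 * s P2 P4 * s P2 P5 - 2%:R * s P1 P5 * s P2 P2 * s P3 P4
            + s P1 P3 * s P2 P2 * s P4 P5) *: P4)
    & proj_eq P7
        ((s P2 P6 * s P1 P5 * s P4 P6 + s P2 P4 * s P1 P5 * s P6 P6) *: P1
         + (s P1 P1 * (s P2 P6 * s P4 P5 + s P2 P4 * s P5 P6)) *: P6)].
Proof.
have K2 : 2%:R != 0 :> complex R by rewrite pnatr_eq0.
exact: (C5_eigenpoints K2 f_cubic P_neq0 P_eigen P_C5).
Qed.
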